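(* Let $n = p^k m^2$ be an odd perfect number, where $p$ is prime, $p \equiv k \equiv 1 \pmod 4$ and $\gcd(p,m)=1$. If $\sigma(m^2)/p^k$ is a perfect square, then $p \geq 17$.
   Context: $\sigma(z)$ denotes the sum of the positive divisors of $z$. An odd perfect number is an odd positive integer $n$ with $\sigma(n) = 2n$. By Euler, any odd perfect number has the form $n = p^k m^2$ with $p$ prime, $p \equiv k \equiv 1 \pmod 4$ and $\gcd(p,m)=1$; $p$ is called the special prime. (For such $n$, $\sigma(m^2)/p^k$ is an integer.) *)

(* Defs.v *)
From mathcomp Require Import all_boot.

Set Implicit Arguments.
Unset Strict Implicit.
Unset Printing Implicit Defensive.

(* The sum of the positive divisors of n, for n > 0 (divisors 0 is empty). *)
Definition sigma (n : nat) : nat := \sum_(d <- divisors n) d.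

Definition odd_perfect (n : nat) : Prop := odd n /\ sigma n = 2 * n.

Definition perfect_square (x : nat) : Prop := exists a : nat, x = a ^ 2.

(* Main.v *)
Require Import Defs.
From mathcomp Require Import all_boot.

(** Since [sigma] is multiplicative, perfection of [n] together with
    [sigma (m ^ 2) = p ^ k * a ^ 2] gives [sigma (p ^ k) * a ^ 2 = 2 * m ^ 2].
    As [sigma (p ^ k)] is 1 modulo [p], this reads [a ^ 2 = 2 * m ^ 2] modulo
    [p] with [m] invertible, so 2 is a square modulo [p]; this fails for 5 and
    13, the only primes below 17 that are 1 modulo 4. *)

Lemma gcdn_mul_coprime d m n :
  coprime m n -> d %| m * n -> gcdn m d * gcdn n d = d.
Proof.
move=> co_mn d_mn; apply/eqP; rewrite eqn_dvd; apply/andP; split.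
  rewrite Gauss_dvd ?dvdn_gcdr //.
  exact: coprime_dvdl (dvdn_gcdl _ _) (coprime_dvdr (dvdn_gcdl _ _) co_mn).
(* The product expands into a gcd of [m * n], [m * d], [d * n] and [d * d], all multiples of [d]. *)
rewrite muln_gcdl dvdn_gcd !muln_gcdr !dvdn_gcd d_mn.
by rewrite !(dvdn_mulr _ (dvdnn d), dvdn_mull _ (dvdnn d)).
Qed.

(** The map [d |-> (gcdn m d, gcdn n d)] inverts multiplication of divisor pairs: one composite
    gives injectivity, the other, [gcdn_mul_coprime], surjectivity. *)
Lemma perm_divisorsM m n : 0 < m -> 0 < n -> coprime m n ->
  perm_eq (divisors (m * n)) [seq x * y | x <- divisors m, y <- divisors n].
Proof.
move=> m_gt0 n_gt0 co_mn; apply: uniq_perm.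
- exact: divisors_uniq.
- apply: allpairs_uniq; rewrite ?divisors_uniq //.
  suff gcdK z : z \in [seq (x, y) | x <- divisors m, y <- divisors n] ->
      (gcdn m (uncurry muln z), gcdn n (uncurry muln z)) = z.
    by move=> u v /gcdK {2}<- /gcdK {2}<- ->.
  case/allpairsP=> -[x y] /= [+ + ->]; rewrite -!dvdn_divisors //= => x_m y_n.
  rewrite Gauss_gcdl ?(coprime_dvdr y_n) //.
  rewrite Gauss_gcdr; last by rewrite coprime_sym (coprime_dvdl x_m).
  by rewrite (gcdn_idPr x_m) (gcdn_idPr y_n).
- move=> d; rewrite -dvdn_divisors ?muln_gt0 ?m_gt0 //.
  apply/idP/allpairsP => [d_mn | [[x y] /= [+ + ->]]].
    exists (gcdn m d, gcdn n d).
    by rewrite /= -!dvdn_divisors // !dvdn_gcdl gcdn_mul_coprime.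
  by rewrite -!dvdn_divisors //; apply: dvdn_mul.
Qed.

Lemma sigmaM m n : 0 < m -> 0 < n -> coprime m n ->
  sigma (m * n) = sigma m * sigma n.
Proof.
move=> m_gt0 n_gt0 co_mn.
rewrite /sigma (perm_big _ (perm_divisorsM m n m_gt0 n_gt0 co_mn)) /=.
by rewrite big_allpairs_dep big_distrl; apply: eq_bigr => x _; rewrite big_distrr.
Qed.

(** Every divisor of [p ^ k] other than 1 is a multiple of [p]. *)
Lemma sigma_pfactor_mod p k : prime p -> sigma (p ^ k) = 1 %[mod p].
Proof.
move=> p_pr; rewrite /sigma (bigD1_seq 1) ?divisor1 ?divisors_uniq //=.
suff /eqP p_sum: p %| \sum_(d <- divisors (p ^ k) | d != 1) d.
  by rewrite -modnDmr p_sum addn0.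
rewrite big_seq_cond; apply: dvdn_sum => d /andP[].
rewrite -dvdn_divisors ?expn_gt0 ?prime_gt0 //.
by case/(dvdn_pfactor _ _ p_pr) => -[|j] _ -> // _; rewrite dvdn_exp.
Qed.

Lemma two_nonsquare_mod p a m : prime p -> p = 1 %[mod 4] -> p < 17 ->
  coprime p m -> a ^ 2 <> 2 * m ^ 2 %[mod p].
Proof.
(* Passing to the residues of [a] and [m] leaves finitely many cases; coprimality excludes the
   residue 0 for [m]. *)
move=> p_pr p_mod4 p_lt17; rewrite -coprime_modr -modnXm -[in RHS]modnMmr.
rewrite -[in RHS]modnXm modnMmr.
have := ltn_pmod a (prime_gt0 p_pr); have := ltn_pmod m (prime_gt0 p_pr).
have [-> | ->]: p = 5 \/ p = 13.
  by move: p p_pr p_mod4 p_lt17; do 17?[case=> //]; auto.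
  by move: (a %% 5) (m %% 5); do 5?[case=> //]; do 5?[case=> //].
by move: (a %% 13) (m %% 13); do 13?[case=> //]; do 13?[case=> //].
Qed.

(* The quotient sigma (m ^ 2) %/ p ^ k is exact: under the hypotheses,
   p ^ k divides sigma (p ^ k) * sigma (m ^ 2) = 2 * p ^ k * m ^ 2 and
   is coprime to sigma (p ^ k). *)
Theorem theorem3 (n p k m : nat)
    (hn : odd_perfect n) (hnpkm : n = p ^ k * m ^ 2)
    (hp : prime p) (hp4 : p = 1 %[mod 4]) (hk4 : k = 1 %[mod 4])
    (hpm : coprime p m)
    (hsq : perfect_square (sigma (m ^ 2) %/ p ^ k)) :
  17 <= p.
Proof.
case: hn => n_odd; rewrite hnpkm; case: hsq => a def_a.
have pk_gt0: 0 < p ^ k by rewrite expn_gt0 prime_gt0.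
(* Otherwise [n] would be 0, which is even. *)
have m2_gt0: 0 < m ^ 2.
  by case: (m ^ 2) hnpkm n_odd => // ->; rewrite muln0.
have co_pk_m2: coprime (p ^ k) (m ^ 2) by rewrite coprimeXl ?coprimeXr.
rewrite sigmaM // => perf.
have sigma_pk := sigma_pfactor_mod p k hp.
have co_pk_sigma: coprime (p ^ k) (sigma (p ^ k)).
  by rewrite coprimeXl // -coprime_modr sigma_pk coprime_modr coprimen1.
have pk_sigma: p ^ k %| sigma (m ^ 2).
  by rewrite -(Gauss_dvdr _ co_pk_sigma) perf mulnCA dvdn_mulr.
have eq_a: sigma (p ^ k) * a ^ 2 = 2 * m ^ 2.
  apply/eqP; rewrite -(eqn_pmul2r pk_gt0) -mulnA -def_a divnK // perf.
  by rewrite -mulnA (mulnC (p ^ k)).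
rewrite leqNgt; apply/negP => p_lt17.
apply: (two_nonsquare_mod p a m hp hp4 p_lt17 hpm).
by rewrite -eq_a -modnMml sigma_pk modnMml mul1n.
Qed.
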